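(* Let $(\Omega,\mathcal F,(\mathcal F_t)_{t\ge 0},\mathbb P)$ be a complete filtered probability space, let $M\ge 1$ and $T\ge 1$ be integers, let $\varepsilon\in(0,1)$ and $\delta\in(0,1)$ be fixed, and let $c_0,c_x>0$ be constants. Let $\mathbf z_0$ be an $\mathcal F_0$-measurable random vector in $\mathbb R^M$ with $\mathbb E[\|\mathbf z_0\|^2]=1$ and $\big|\|\mathbf z_0\|^2-1\big|\le \varepsilon/2$ almost surely. Let $(\mathbf z_t)_{t\ge1}\subset\mathbb R^M$ be a stochastic process adapted to $(\mathcal F_t)_{t\ge 1}$ that is conditionally $\sqrt{c_0/M}$-sub-Gaussian and such that each $\mathbf z_t$, $t\ge1$, satisfies $\|\mathbf z_t\|=1$ almost surely. Let $(x_t)_{t\ge1}\subset\mathbb R$ be a stochastic process adapted to $(\mathcal F_{t-1})_{t\ge1}$ (that is, $x_t$ is $\mathcal F_{t-1}$-measurable for each $t\ge 1$) with $x_t^2\le c_x$ almost surely for all $t\ge1$. Then for any fixed (deterministic) $x_0\in\mathbb R\setminus\{0\}$, if $$M\ \ge\ \frac{16c_0(1+\varepsilon)}{\varepsilon^2}\left(\log\left(\frac1\delta\right)+\log\left(1+\frac{c_xT}{x_0^2}\right)\right),$$ then with probability at least $1-\delta$, $$\forall t\in\{0,1,\dots,T\},\qquad (1-\varepsilon)\left(\sum_{i=0}^t x_i^2\right)\ \le\ \left\|\sum_{i=0}^t x_i\mathbf z_i\right\|^2\ \le\ (1+\varepsilon)\left(\sum_{i=0}^t x_i^2\right).$$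
   Context: $\|\cdot\|$ is the Euclidean norm on $\mathbb R^M$ and $\mathbb S^{M-1}$ is the unit sphere of $\mathbb R^M$. Conditionally sub-Gaussian: for a constant $\sigma>0$, a real process $(X_t)_{t\ge1}$ adapted to $(\mathcal F_t)_{t\ge1}$ is conditionally $\sigma$-sub-Gaussian if for all $t\ge 1$ and all $\lambda\in\mathbb R$, $\mathbb E[\exp(\lambda X_t)\mid\mathcal F_{t-1}]\le\exp(\lambda^2\sigma^2/2)$ almost surely. An $\mathbb R^M$-valued adapted process $(X_t)_{t\ge1}$ is conditionally $\sigma$-sub-Gaussian if for every fixed $v\in\mathbb S^{M-1}$ the real process $(\langle v,X_t\rangle)_{t\ge1}$ is conditionally $\sigma$-sub-Gaussian. *)

(* Defs.v *)
From HB Require Import structures.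
From mathcomp Require Import all_boot all_order all_algebra.
From mathcomp Require Import all_classical all_reals all_analysis.
Import Order.TTheory GRing.Theory Num.Theory.
Import numFieldNormedType.Exports.

Set Implicit Arguments.
Unset Strict Implicit.
Unset Printing Implicit Defensive.

Local Open Scope classical_set_scope.
Local Open Scope ring_scope.

Definition dotv (R : realType) (M : nat) (u v : 'rV[R]_M) : R :=
  \sum_(j < M) u 0 j * v 0 j.

(* The canonical norm `| v | on 'rV[R]_M is the sup norm, hence this one. *)
Definition enorm (R : realType) (M : nat) (v : 'rV[R]_M) : R :=
  Num.sqrt (dotv v v).

(* R^M with its Borel sigma-algebra. The library topology on 'rV[R]_M comes
   from the sup norm, so its open sets are the Euclidean ones. *)
Notation borel_rV R M := (g_sigma_algebraType (@open 'rV[R]_M)).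

(* For G a sigma-algebra, the measurable sets of g_sigma_algebraType G are
   exactly the members of G. *)
Definition measurable_wrt (T : pointedType) (G : set (set T))
    (d : measure_display) (U : measurableType d) (X : T -> U) : Prop :=
  measurable_fun [set: g_sigma_algebraType G]
    (X : g_sigma_algebraType G -> U).

Definition filtration (d : measure_display) (T : measurableType d)
    (F : nat -> set (set T)) : Prop :=
  [/\ forall t, sigma_algebra [set: T] (F t),
      forall t, F t `<=` measurable
    & forall s t, (s <= t)%N -> F s `<=` F t].

(* Completeness of (T, F, P): the probability space is complete and F_0 (hence
   every F_t) contains all negligible sets. *)
Definition complete_filtered_space (d : measure_display)
    (T : measurableType d) (R : realType) (P : probability T R)
    (F : nat -> set (set T)) : Prop :=
  [/\ filtration F, measure_is_complete P & P.-negligible `<=` F 0%N].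

(* processes are indexed by t >= 1; the value at t = 0 is not constrained *)
Definition adapted (T : pointedType) (F : nat -> set (set T))
    (d : measure_display) (U : measurableType d) (X : nat -> T -> U) : Prop :=
  forall t, (1 <= t)%N -> measurable_wrt (F t) (X t).

(* W is a version of E[Y | G] *)
Definition is_cond_exp (d : measure_display) (T : measurableType d)
    (R : realType) (P : probability T R) (G : set (set T)) (Y W : T -> R)
    : Prop :=
  [/\ P.-integrable setT (EFin \o Y),
      measurable_wrt G W,
      P.-integrable setT (EFin \o W)
    & forall A, G A ->
        (\int[P]_(w in A) (W w)%:E = \int[P]_(w in A) (Y w)%:E)%E].

(* Versions of a conditional expectation agree almost surely, so an almost sure
   bound may be stated for one of them. *)
Definition cond_exp_le (d : measure_display) (T : measurableType d)
    (R : realType) (P : probability T R) (G : set (set T)) (Y : T -> R) (c : R)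
    : Prop :=
  exists2 W : T -> R, is_cond_exp P G Y W & \forall w \ae P, W w <= c.

Definition cond_subgaussian (d : measure_display) (T : measurableType d)
    (R : realType) (P : probability T R) (F : nat -> set (set T)) (sigma : R)
    (X : nat -> T -> R) : Prop :=
  forall t, (1 <= t)%N -> forall lambda : R,
    cond_exp_le P (F t.-1) (fun w => expR (lambda * X t w))
      (expR (lambda ^+ 2 * sigma ^+ 2 / 2)).

Definition cond_subgaussian_vec (d : measure_display) (T : measurableType d)
    (R : realType) (P : probability T R) (F : nat -> set (set T)) (M : nat)
    (sigma : R) (X : nat -> T -> 'rV[R]_M) : Prop :=
  forall v : 'rV[R]_M, enorm v = 1 ->
    cond_subgaussian P F sigma (fun t w => dotv v (X t w)).

(* Main.v *)
(* Put S_t = sum_(i <= t) x_i z_i and V_t = sum_(i <= t) x_i^2. Since the z_i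
   are unit vectors, the increments of Y_t = |S_t|^2 - V_t are
   2 x_t <S_(t-1), z_t>. As long as |S_(t-1)|^2 <= (1 + eps) V_(t-1), such an
   increment is conditionally sub-Gaussian with variance proxy at most
   a (V_t^2 - V_(t-1)^2), where a = 2 (1 + eps) c0 / M. Stop Y the first time
   that |Y_t| > eps V_t. For every l the exponential
   exp (l N - l^2 B / 2) of the stopped martingale N = Y - Y_0 with variance
   proxy B = a (V^2 - V_0^2) has mean at most 1, and averaging over
   l ~ N(0, 1 / (a V_0^2)) gives E[(V_0 / V) exp (N^2 / (2 a V^2))] <= 1. When
   the bound fails, |Y_0| <= eps V_0 / 2 forces |N| >= eps V / 2, and the lower
   bound on M makes the last integrand at least 1 / delta; Markov's inequality
   concludes. *)
Require Import Defs.
From mathcomp Require Import all_boot all_order all_algebra.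
From mathcomp Require Import all_classical all_reals all_analysis.
From mathcomp Require Import measurable_realfun ring lra.
Import Order.TTheory GRing.Theory Num.Theory.
Import numFieldNormedType.Exports.

Local Open Scope classical_set_scope.
Local Open Scope ring_scope.

Set Implicit Arguments.
Unset Strict Implicit.
Unset Printing Implicit Defensive.

(** * Measurability with respect to a sub-sigma-algebra *)

Lemma measurable_wrt_le (T : pointedType) (G H : set (set T))
    (d : measure_display) (U : measurableType d) (X : T -> U) :
  G `<=` H -> measurable_wrt G X -> measurable_wrt H X.
Proof.
move=> GH mX _ A mA; have /= GA := mX measurableT A mA.
exact: (sub_smallest2r (@smallest_sigma_algebra _ _ _) GH) GA.
Qed.

Lemma measurable_wrt_fun (d0 : measure_display) (T : measurableType d0)
    (G : set (set T)) (d : measure_display) (U : measurableType d)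
    (X : T -> U) :
  G `<=` measurable -> measurable_wrt G X -> measurable_fun [set: T] X.
Proof.
move=> Gm mX _ A mA; have := mX measurableT A mA.
apply: smallest_sub => //=; exact: sigma_algebra_measurable.
Qed.

Lemma measurable_wrt_preimage (T : pointedType) (G : set (set T))
    (d : measure_display) (U : measurableType d) (X : T -> U) (A : set U) :
  sigma_algebra [set: T] G -> measurable_wrt G X -> measurable A ->
  G (X @^-1` A).
Proof.
move=> sG mX mA; have := mX measurableT A mA.
by rewrite setTI measurable_g_measurableTypeE.
Qed.

Lemma measurable_wrt_coord (T : pointedType) (G : set (set T)) (R : realType)
    (M : nat) (X : T -> 'rV[R]_M) (j : 'I_M) :
  measurable_wrt (U := borel_rV R M) G X ->
  measurable_wrt G (fun w => X w 0 j).
Proof.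
move=> mX.
have mj : measurable_fun [set: borel_rV R M] (fun v : borel_rV R M => v 0 j).
  (* Open intervals generate the Borel sets of the line, and their preimages under a continuous
     coordinate are open. *)
  apply: (measurability _ (RGenOpens.measurableE R)).
  move=> _ [_ [a [b ->]] <-]; rewrite setTI; apply: sub_sigma_algebra.
  by apply: open_comp; [move=> v _; exact: coord_continuous|exact: interval_open].
exact: (measurableT_comp mj mX).
Qed.

(** * Rounding to a grid and countable partitions *)

(* (sign, rounded modulus): countably many codes for the multiples of e. *)
Definition rtz_code (R : realType) (e r : R) : bool * nat :=
  (0 <= r, Num.trunc (`|r| / e)).

Definition rtz (R : realType) (e : R) (c : bool * nat) : R :=
  (-1) ^+ (~~ c.1) * (c.2%:R * e).

(** The truncated quotient [k] satisfies [k * e <= |r| < (k + 1) * e] and the sign is kept, so [r]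
    moves towards 0 by less than [e]. *)
Lemma rtz_bounds (R : realType) (e r : R) : 0 < e ->
  `|r - rtz e (rtz_code e r)| <= e /\ rtz e (rtz_code e r) ^+ 2 <= r ^+ 2.
Proof.
move=> e0; have e1 : 0 <= `|r| / e by rewrite divr_ge0 // ltW.
have /andP[] := truncn_itv e1; rewrite ler_pdivlMr // ltr_pdivrMr //.
rewrite /rtz /rtz_code /=; move: (Num.trunc _) => k hl.
rewrite -natr1 mulrDl mul1r => hu.
have k0 : 0 <= k%:R * e by rewrite mulr_ge0 // ltW.
have [r0|r0] := leP 0 r; rewrite /= ?expr0 ?expr1 ?mul1r ?mulN1r.
  rewrite ger0_norm // in hl hu; split; last by rewrite ler_sqr ?nnegrE.
  by rewrite ger0_norm; lra.
rewrite ltr0_norm // in hl hu; split.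
  by rewrite ler0_norm; lra.
by rewrite sqrrN -(sqrrN r) ler_sqr ?nnegrE //; lra.
Qed.

Lemma measurable_rtz_code (d : measure_display) (T : measurableType d)
    (R : realType) (f : T -> R) (e : R) (c : bool * nat) :
  0 < e -> measurable_fun [set: T] f ->
  measurable [set w | rtz_code e (f w) = c].
Proof.
case: c => b k e0 mf.
have -> : [set w | rtz_code e (f w) = (b, k)] =
    (fun w => 0 <= f w) @^-1` [set b] `&`
    (fun w => `|f w| / e) @^-1` [set` `[k%:R, k.+1%:R[ ].
  apply/seteqP; split => w /=; rewrite /rtz_code in_itv /=.
    by case=> <- <-; split=> //; apply: truncn_itv; rewrite divr_ge0 // ltW.
  by case=> <- /truncn_def <-.
apply: measurableI.
  rewrite -[X in measurable X]setTI.
  by apply: measurable_fun_ler => //; exact: measurable_cst.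
rewrite -[X in measurable X]setTI; apply: measurable_funM => //.
exact: measurableT_comp.
Qed.

(** The fibers of [h] form a countable partition, enumerated by [pickle], so the cellwise
    inequalities add up. *)
Lemma ge0_le_integral_fibers (d : measure_display) (T : measurableType d)
    (R : realType) (mu : {measure set T -> \bar R}) (C : countType)
    (h : T -> C) (f g : T -> \bar R) :
  (forall c, measurable [set w | h w = c]) ->
  measurable_fun [set: T] f -> measurable_fun [set: T] g ->
  (forall w, (0 <= f w)%E) -> (forall w, (0 <= g w)%E) ->
  (forall c, \int[mu]_(w in [set w | h w = c]) f w
               <= \int[mu]_(w in [set w | h w = c]) g w)%E ->
  (\int[mu]_w f w <= \int[mu]_w g w)%E.
Proof.
move=> mh mf mg f0 g0 fg.
pose D k := [set w | pickle (h w) = k].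
(* An index that is not the code of a value of [h] gives an empty cell. *)
have DE k : D k = set0 \/ exists c, D k = [set w | h w = c].
  case: (pselect (exists w, D k w)) => [[w0 <-]|nD]; last first.
    by left; rewrite -subset0 => w Dw; apply: nD; exists w.
  right; exists (h w0); apply/seteqP; split => w /=; rewrite /D /=.
    exact: (pcan_inj pickleK).
  by move=> ->.
have mD k : measurable (D k) by case: (DE k) => [->//|[c ->]].
have UD : \bigcup_k D k = setT.
  by apply/seteqP; split => // w _; exists (pickle (h w)).
have tD : trivIset setT D.
  by apply/trivIsetP => i j _ _ ij; rewrite -subset0 => w [Di Dj];
  case/eqP: ij; rewrite -Di -Dj.
rewrite -UD !ge0_integral_bigcup //; try by rewrite UD.
apply: lee_nneseries => [k _ _|k _].
  by apply: integral_ge0 => w _.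
by case: (DE k) => [->|[c ->]]; rewrite ?integral_set0.
Qed.

(** * The Euclidean inner product *)

Lemma dotvC (R : realType) (M : nat) (u v : 'rV[R]_M) : dotv u v = dotv v u.
Proof. by apply: eq_bigr => j _; rewrite mulrC. Qed.

Lemma dotvZl (R : realType) (M : nat) (a : R) (u v : 'rV[R]_M) :
  dotv (a *: u) v = a * dotv u v.
Proof. by rewrite /dotv mulr_sumr; apply: eq_bigr => j _; rewrite mxE mulrA. Qed.

Lemma dotvDl (R : realType) (M : nat) (u u' v : 'rV[R]_M) :
  dotv (u + u') v = dotv u v + dotv u' v.
Proof.
by rewrite /dotv -big_split; apply: eq_bigr => j _; rewrite mxE mulrDl.
Qed.

Lemma dotvv_ge0 (R : realType) (M : nat) (v : 'rV[R]_M) : 0 <= dotv v v.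
Proof. by apply: sumr_ge0 => j _; rewrite -expr2 sqr_ge0. Qed.

Lemma enorm_sqr (R : realType) (M : nat) (v : 'rV[R]_M) :
  enorm v ^+ 2 = dotv v v.
Proof. by rewrite sqr_sqrtr // dotvv_ge0. Qed.

Lemma dotvv_eq0 (R : realType) (M : nat) (v : 'rV[R]_M) :
  dotv v v = 0 -> v = 0.
Proof.
move=> /eqP; rewrite psumr_eq0 => [/allP h|j _]; last by rewrite -expr2 sqr_ge0.
apply/rowP => j; have := h j (mem_index_enum _).
by rewrite /= mulf_eq0 orbb mxE => /eqP.
Qed.

Lemma coord_le1 (R : realType) (M : nat) (v : 'rV[R]_M) (j : 'I_M) :
  enorm v = 1 -> `|v 0 j| <= 1.
Proof.
move=> v1; rewrite -(@ler_pXn2r _ 2) ?nnegrE // expr1n real_normK ?num_real //.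
rewrite -[leRHS](expr1n R 2) -v1 enorm_sqr /dotv (bigD1 j) //= expr2 lerDl.
by apply: sumr_ge0 => i _; rewrite -expr2 sqr_ge0.
Qed.

Lemma measurable_dotv (d : measure_display) (T : measurableType d)
    (R : realType) (M : nat) (u v : T -> 'rV[R]_M) :
  (forall j, measurable_fun [set: T] (fun w => u w 0 j)) ->
  (forall j, measurable_fun [set: T] (fun w => v w 0 j)) ->
  measurable_fun [set: T] (fun w => dotv (u w) (v w)).
Proof.
move=> mu mv; apply: measurable_sum => j.
by apply: measurable_funM.
Qed.

(** * Exponential moments along fixed and predictable directions *)

(** On [A] in [G], [Y] and its version [W] have the same integral, and [W <= c] off a null set. The
    conditional bounds enter the proof only in this integrated form. *)
Lemma cond_exp_le_integral (d : measure_display) (T : measurableType d)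
    (R : realType) (P : probability T R) (G : set (set T)) (Y : T -> R)
    (c : R) (A : set T) :
  0 <= c -> G `<=` measurable -> cond_exp_le P G Y c -> G A ->
  (\int[P]_(w in A) (Y w)%:E <= c%:E * P A)%E.
Proof.
move=> c0 Gm [W [iY mW iW WY] [N [mN N0 WN]]] GA; rewrite -(WY _ GA).
have mA := Gm _ GA.
rewrite (@negligible_integral _ _ _ _ A N) //; last first.
  exact: (@integrableS _ _ _ _ setT).
have mAN : measurable (A `\` N) by exact: measurableD.
apply: (@le_trans _ _ (\int[P]_(w in A `\` N) (cst c%:E) w)%E).
  apply: le_integral => //.
  - exact: (@integrableS _ _ _ _ setT).
  - by apply: (@integrableS _ _ _ _ setT) => //; exact: finite_measure_integrable_cst.
  - move=> w; rewrite inE => -[_ Nw]; rewrite lee_fin /=.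
    by apply: contrapT => nW; apply: Nw; exact: WN.
rewrite integral_cst // lee_wpmul2l ?lee_fin //.
by apply: le_measure; rewrite ?inE //; exact: subDsetl.
Qed.

(** Homogeneity: the sub-Gaussian bound is applied to the unit vector [v / |v|] with [lambda = |v|].
    The zero vector has no direction and is treated apart. *)
Lemma cond_subgaussian_vec_integral (d : measure_display)
    (T : measurableType d) (R : realType) (P : probability T R)
    (F : nat -> set (set T)) (M : nat) (sigma : R)
    (X : nat -> T -> 'rV[R]_M) (t : nat) (A : set T) (v : 'rV[R]_M) :
  filtration F -> cond_subgaussian_vec P F sigma X -> (1 <= t)%N ->
  F t.-1 A ->
  (\int[P]_(w in A) (expR (dotv v (X t w)))%:E
     <= (expR (sigma ^+ 2 / 2 * dotv v v))%:E * P A)%E.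
Proof.
move=> [_ Fm _] hX t1 FA.
have [v0|v0] := eqVneq (dotv v v) 0.
  have X0 : (fun w => (expR (dotv v (X t w)))%:E) = cst 1%E.
    apply/funext => w; rewrite (dotvv_eq0 v0) /dotv big1 ?expR0 // => j _.
    by rewrite mxE mul0r.
  by rewrite X0 v0 mulr0 expR0 integral_cst //; exact: (Fm t.-1).
have n0 : enorm v != 0.
  by apply: contra v0 => /eqP n0; rewrite -enorm_sqr n0 expr0n.
have u1 : enorm ((enorm v)^-1 *: v) = 1.
  move: (enorm_sqr v) n0; set n := enorm v => nE n0.
  rewrite /enorm dotvZl dotvC dotvZl -nE (_ : _ * _ = 1) ?sqrtr1 //.
  by rewrite expr2 mulKf // mulVf.
have := hX _ u1 t t1 (enorm v).
under eq_fun do rewrite dotvZl mulrA mulfV // mul1r.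
rewrite enorm_sqr (_ : _ / 2 = sigma ^+ 2 / 2 * dotv v v); last by field.
by move=> /cond_exp_le_integral; apply; rewrite ?expR_ge0.
Qed.

(* The direction u is rounded coordinatewise towards zero onto a grid, so that
   on each of the countably many cells the bound for fixed directions applies
   while the squared norm of the direction does not grow. *)
Lemma predictable_direction_integral (d : measure_display)
    (T : measurableType d) (R : realType) (P : probability T R)
    (G : set (set T)) (M : nat) (c : R) (Z u : T -> 'rV[R]_M) (om : T -> R) :
  0 <= c -> sigma_algebra [set: T] G -> G `<=` measurable ->
  (forall j, measurable_fun [set: T] (fun w => Z w 0 j)) ->
  (\forall w \ae P, forall j, `|Z w 0 j| <= 1) ->
  (forall A v, G A ->
     (\int[P]_(w in A) (expR (dotv v (Z w)))%:E
        <= (expR (c * dotv v v))%:E * P A)%E) ->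
  measurable_wrt G om -> (forall j, measurable_wrt G (fun w => u w 0 j)) ->
  (\int[P]_w (expR (om w + dotv (u w) (Z w)))%:E
     <= \int[P]_w (expR (om w + c * dotv (u w) (u w)))%:E)%E.
Proof.
move=> c0 sG Gm mZ Z1 hZ Gom Gu.
have mom := measurable_wrt_fun Gm Gom.
have mu j := measurable_wrt_fun Gm (Gu j).
have muZ := measurable_dotv mu mZ.
have muu := measurable_dotv mu mu.
have mf : measurable_fun [set: T] (fun w => (expR (om w + dotv (u w) (Z w)))%:E).
  by apply/measurable_EFinP; apply: measurableT_comp => //; exact: measurable_funD.
have mg : measurable_fun [set: T]
    (fun w => (expR (om w + c * dotv (u w) (u w)))%:E).
  apply/measurable_EFinP; apply: measurableT_comp => //.
  by apply: measurable_funD => //; exact: measurable_funM.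
(* A grid of mesh [e] costs a factor [expR (e * (M + 2))]: [e] for each coordinate of [u], and [e]
   twice for [om], which is rounded and then restored. This factor tends to 1 with [e]. *)
suff H e : 0 < e -> (\int[P]_w (expR (om w + dotv (u w) (Z w)))%:E
    <= (expR (e *+ M.+2))%:E *
       \int[P]_w (expR (om w + c * dotv (u w) (u w)))%:E)%E.
  apply/lee_mul01Pr; first by apply: integral_ge0 => w _; rewrite lee_fin expR_ge0.
  move=> r /andP[r0 r1].
  (* With this mesh the loss factor is exactly [r^-1]. *)
  have l0 : 0 < - ln r / M.+2%:R.
    by rewrite divr_gt0 // oppr_gt0 ln_lt0 // r0.
  have := H _ l0; rewrite -[_ *+ M.+2]mulr_natr mulfVK ?pnatr_eq0 //.
  rewrite expRN lnK ?posrE // => {}H.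
  apply: (le_trans (lee_wpmul2l _ H)); first by rewrite lee_fin ltW.
  by rewrite muleA -EFinM mulfV ?gt_eqF // mul1e.
move=> e0.
have K0 : (0 <= (expR (e *+ M.+2))%:E)%E by rewrite lee_fin expR_ge0.
have g0 w : (0 <= (expR (om w + c * dotv (u w) (u w)))%:E)%E.
  by rewrite lee_fin expR_ge0.
rewrite -ge0_integralZl //.
(* The cells on which [om] and every coordinate of [u] have constant codes are countably many and
   belong to [G]. *)
pose h w := (rtz_code e (om w), [ffun j => rtz_code e (u w 0 j)]).
have Gh k : G [set w | h w = k].
  case: k => k0 k.
  have -> : [set w | h w = (k0, k)] = (om @^-1` [set r | rtz_code e r = k0]) `&`
     \bigcap_(j in [set: 'I_M]) ((fun w => u w 0 j) @^-1` [set r | rtz_code e r = k j]).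
    apply/seteqP; split => w /=.
      by move=> [<- <-]; split=> // j _; rewrite /= ffunE.
    by move=> [h1 h2]; congr (_, _) => //; apply/ffunP => j; rewrite ffunE; exact: h2.
  rewrite -(measurable_g_measurableTypeE sG); apply: measurableI.
    rewrite -[X in measurable X]setTI; apply: Gom => //.
    exact: (@measurable_rtz_code _ _ _ id).
  apply: fin_bigcap_measurable => // j _.
  rewrite -[X in measurable X]setTI; apply: Gu => //.
  exact: (@measurable_rtz_code _ _ _ id).
have mh k : measurable [set w | h w = k] by exact: Gm.
apply: (ge0_le_integral_fibers mh) => //.
  by apply: emeasurable_funM => //; exact: measurable_cst.
case=> k0 k; set D := [set w | _].
have mD : measurable D by exact: mh.
pose v : 'rV[R]_M := \row_j rtz e (k j).
have vu w : D w -> forall j, `|u w 0 j - v 0 j| <= e /\ v 0 j ^+ 2 <= u w 0 j ^+ 2.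
  by move=> [_ kE] j; rewrite mxE -kE ffunE; exact: rtz_bounds.
have vom w : D w -> `|om w - rtz e k0| <= e.
  by move=> [kE _]; rewrite -kE; case: (rtz_bounds (om w) e0).
have vv w : D w -> dotv v v <= dotv (u w) (u w).
  move=> Dw; apply: ler_sum => j _; rewrite -!expr2.
  by case: (vu w Dw j).
have uvZ w : D w -> (forall j, `|Z w 0 j| <= 1) ->
    dotv (u w) (Z w) <= dotv v (Z w) + e *+ M.
  move=> Dw Zw; rewrite -lerBlDl -sumrB.
  rewrite -[X in e *+ X]card_ord -sumr_const; apply: ler_sum => j _.
  rewrite -mulrBl; apply: (le_trans (ler_norm _)); rewrite normrM -[leRHS]mulr1.
  by apply: ler_pM => //; case: (vu w Dw j).
have vZ0 w : (0 <= (expR (dotv v (Z w)))%:E)%E by rewrite lee_fin expR_ge0.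
have mvZ : measurable_fun D (fun w => (expR (dotv v (Z w)))%:E).
  apply: measurable_funTS; apply/measurable_EFinP; apply: measurableT_comp => //.
  by apply: measurable_dotv => // j; exact: measurable_cst.
(* On the cell, [om <= rtz e k0 + e], and replacing [u] by [v] changes the inner product by at most
   [e] per coordinate since [|Z_j| <= 1]. *)
set K := rtz e k0 + e + e *+ M.
apply: (@le_trans _ _ (\int[P]_(w in D) ((expR K)%:E * (expR (dotv v (Z w)))%:E))%E).
  apply: ae_ge0_le_integral => //.
  - exact: measurable_funTS.
  - by apply: emeasurable_funM => //; exact: measurable_cst.
  apply: filterS Z1 => w Zw Dw; rewrite -EFinM lee_fin -expRD ler_expR.
  have := uvZ w Dw Zw; have := vom w Dw; rewrite ler_norml /K => /andP[].
  move: (dotv _ _) (dotv _ _) (e *+ M) => ? ? ?; lra.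
rewrite [leLHS]ge0_integralZl //.
have EK0 : (0 <= (expR K)%:E)%E by rewrite lee_fin expR_ge0.
have DK := lee_wpmul2l EK0 (hZ D v (Gh _)).
apply: (le_trans DK).
rewrite muleA -EFinM -expRD -integral_cst //; apply: ge0_le_integral => //.
- by move=> w _; rewrite lee_fin expR_ge0.
- apply: measurable_funTS; apply: emeasurable_funM => //; exact: measurable_cst.
move=> w Dw; rewrite -EFinM lee_fin -expRD ler_expR.
have := ler_wpM2l c0 (vv w Dw); have := vom w Dw; rewrite ler_norml /K => /andP[].
rewrite !mulrS.
move: (c * dotv _ _) (c * dotv _ _) (e *+ M) => ? ? ?; lra.
Qed.

(** Supermartingale induction: given [F n], the last exponential has mean at most
    [expR (sigma ^+ 2 * |u n|^2 / 2)], which the compensator [beta n / 2] absorbs. *)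
Lemma exp_sum_integral_le1 (d : measure_display) (T : measurableType d)
    (R : realType) (P : probability T R) (F : nat -> set (set T)) (M : nat)
    (sigma : R) (X u : nat -> T -> 'rV[R]_M) (beta : nat -> T -> R) (n : nat) :
  filtration F -> cond_subgaussian_vec P F sigma X ->
  adapted (U := borel_rV R M) F X ->
  (forall t, (1 <= t)%N -> \forall w \ae P, enorm (X t w) = 1) ->
  (forall i j, measurable_wrt (F i) (fun w => u i w 0 j)) ->
  (forall i, measurable_wrt (F i) (beta i)) ->
  (forall i w, sigma ^+ 2 * dotv (u i w) (u i w) <= beta i w) ->
  (\int[P]_w (expR (\sum_(i < n) dotv (u i w) (X i.+1 w)
                    - (\sum_(i < n) beta i w) / 2))%:E <= 1)%E.
Proof.
move=> hF hX aX X1 mu mb ub; have [sF Fm leF] := hF.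
have mX i j : measurable_wrt (F i.+1) (fun w => X i.+1 w 0 j).
  by apply: measurable_wrt_coord; exact: aX.
elim: n => [|n IH].
  under eq_integral do rewrite !big_ord0 mul0r subrr expR0.
  by rewrite integral_cst // mul1e; exact: probability_le1.
(* The sum of [beta] runs one term further: [beta n] is already known at time [n], so [om] is
   [F n]-measurable. *)
pose om w := \sum_(i < n) dotv (u i w) (X i.+1 w)
  - (\sum_(i < n.+1) beta i w) / 2.
have mom : measurable_wrt (F n) om.
  rewrite /measurable_wrt; apply: measurable_funB.
    apply: measurable_sum => i; apply: measurable_dotv => j.
      by apply: measurable_wrt_le (mu i j); apply: leF; exact: ltnW.
    by apply: measurable_wrt_le (mX i j); exact: leF.
  apply: measurable_funM => //; apply: measurable_sum => i.
  by apply: measurable_wrt_le (mb i); apply: leF; rewrite -ltnS.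
have c0 : 0 <= sigma ^+ 2 / 2 by rewrite divr_ge0 // sqr_ge0.
have mXn j : measurable_fun [set: T] (fun w => X n.+1 w 0 j).
  exact: measurable_wrt_fun (Fm _) (mX n j).
have Xn1 : \forall w \ae P, forall j, `|X n.+1 w 0 j| <= 1.
  by apply: filterS (X1 n.+1 isT) => w Xw j; exact: coord_le1.
have hn A v : F n A -> (\int[P]_(w in A) (expR (dotv v (X n.+1 w)))%:E
    <= (expR (sigma ^+ 2 / 2 * dotv v v))%:E * P A)%E.
  by move=> FA; exact: (cond_subgaussian_vec_integral (t := n.+1) _ hF hX).
have := predictable_direction_integral c0 (sF n) (Fm n) mXn Xn1 hn mom (mu n).
under eq_integral => w _.
  rewrite /om addrAC -(@big_ord_recr _ _ _ n (fun i => dotv (u i w) (X i.+1 w))).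
  over.
move=> /le_trans; apply; apply: le_trans IH; apply: ge0_le_integral => //.
- apply/measurable_EFinP; apply: measurableT_comp => //.
  apply: measurable_funD; first exact: measurable_wrt_fun mom.
  apply: measurable_funM => //.
  by apply: measurable_dotv => j; exact: measurable_wrt_fun (mu n j).
- apply/measurable_EFinP; apply: measurableT_comp => //; apply: measurable_funB.
    apply: measurable_sum => i; apply: measurable_dotv => j.
      exact: measurable_wrt_fun (mu i j).
    exact: measurable_wrt_fun (mX i j).
  apply: measurable_funM => //; apply: measurable_sum => i.
  exact: measurable_wrt_fun (mb i).
move=> w _; rewrite lee_fin ler_expR /om big_ord_recr /=.
by have := ub n w; lra.
Qed.

(** * Gaussian mixture and Markov's inequality *)

(** Completing the square in [l]: tilting the centred normal law of precision [rho] gives the normal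
    law of mean [N / (rho + B)] and precision [rho + B], times the total mass. *)
Lemma normal_pdf_tilt (R : realType) (rho B N l : R) : 0 < rho -> 0 <= B ->
  normal_pdf 0 (Num.sqrt rho)^-1 l * expR (l * N - l ^+ 2 * B / 2) =
  Num.sqrt (rho / (rho + B)) * expR (N ^+ 2 / (2 * (rho + B))) *
    normal_pdf (N / (rho + B)) (Num.sqrt (rho + B))^-1 l.
Proof.
move=> r0 B0; have rB0 : 0 < rho + B by rewrite ltr_wpDr.
have pk r : 0 < r -> normal_peak (Num.sqrt r)^-1
    = Num.sqrt r * (Num.sqrt (pi *+ 2))^-1 :> R.
  move=> {}r0; rewrite /normal_peak exprVn sqr_sqrtr ?ltW // -mulrnAr.
  by rewrite sqrtrM ?invr_ge0 ?ltW // sqrtrV ?ltW // invfM invrK.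
rewrite !normal_pdfE ?invr_eq0 ?gt_eqF ?sqrtr_gt0 // !pk //.
rewrite /normal_fun !exprVn !sqr_sqrtr ?ltW //.
rewrite sqrtrM ?ltW // sqrtrV ?ltW //.
have s0 : Num.sqrt (rho + B) != 0 by rewrite gt_eqF // sqrtr_gt0.
set E := expR (N ^+ 2 / _); rewrite -!mulrA -expRD.
rewrite [RHS](_ : _ = Num.sqrt rho * ((Num.sqrt (pi *+ 2))^-1 *
  expR (N ^+ 2 / (2 * (rho + B)) +
     - (l - N / (rho + B)) ^+ 2 / ((rho + B)^-1 *+ 2)))); last first.
  by rewrite expRD -/E; field; rewrite s0 /= gt_eqF // sqrtr_gt0 mulrn_wgt0 // pi_gt0.
congr (_ * (_ * expR _)).
by field; rewrite !gt_eqF.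
Qed.

(* g is the average of expR (l * N - l ^+ 2 * B / 2) over l ~ N(0, 1 / rho). *)
Lemma gaussian_mixture_le1 (d : measure_display)
    (T : measurableType d) (R : realType) (P : probability T R)
    (N B : T -> R) (rho : R) : 0 < rho ->
  measurable_fun [set: T] N -> measurable_fun [set: T] B ->
  (forall w, 0 <= B w) ->
  (forall l, (\int[P]_w (expR (l * N w - l ^+ 2 * B w / 2))%:E <= 1)%E) ->
  let g w := Num.sqrt (rho / (rho + B w))
     * expR (N w ^+ 2 / (2 * (rho + B w))) in
  measurable_fun [set: T] g /\ (\int[P]_w (g w)%:E <= 1)%E.
Proof.
move=> r0 mN mB B0 hl g.
pose s := (Num.sqrt rho)^-1.
pose f (p : T * R) : \bar R := (normal_pdf 0 s p.2 *
   expR (p.2 * N p.1 - p.2 ^+ 2 * B p.1 / 2))%:E.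
have pdf0 m s' l : (0 <= (normal_pdf m s' l)%:E :> \bar R)%E.
  by rewrite lee_fin normal_pdf_ge0.
have mpdf m s' : measurable_fun [set: R] (fun l => (normal_pdf m s' l)%:E).
  by apply/measurable_EFinP; exact: measurable_normal_pdf.
have f0 p : (0 <= f p)%E by rewrite lee_fin mulr_ge0 ?normal_pdf_ge0 ?expR_ge0.
have mN1 : measurable_fun [set: T * R] (fun p => N p.1).
  exact: (measurableT_comp mN).
have mB1 : measurable_fun [set: T * R] (fun p => B p.1).
  exact: (measurableT_comp mB).
have mf : measurable_fun [set: T * R] f.
  apply/measurable_EFinP; apply: measurable_funM.
    exact: (measurableT_comp (measurable_normal_pdf 0 s)).
  apply: measurableT_comp => //; apply: measurable_funB.
    exact: measurable_funM.
  apply: measurable_funM => //; apply: measurable_funM => //.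
  by apply: measurable_funX.
(* When [l] is integrated first, the tilted density has mass 1 and only the prefactor [g]
   remains. *)
have fE : fubini_F lebesgue_measure f = (fun w => (g w)%:E).
  apply/funext => w; rewrite /fubini_F /f /=.
  under eq_integral => l _ do rewrite normal_pdf_tilt // EFinM.
  rewrite ge0_integralZl //; last exact: mpdf.
  by rewrite integral_normal_pdf mule1.
split.
  apply/measurable_EFinP; rewrite /comp -fE.
  exact: measurable_fun_fubini_tonelli_F.
(* In the other order, each [l] contributes at most its prior density, which integrates to 1. *)
rewrite -fE (fubini_tonelli (m1 := P) (m2 := lebesgue_measure) f mf f0).
rewrite /fubini_G -(integral_normal_pdf 0 s); apply: ge0_le_integral => //.
- by move=> l _; apply: integral_ge0.
- exact: measurable_fun_fubini_tonelli_G.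
- exact: mpdf.
move=> l _; rewrite /f /=.
under eq_integral do rewrite EFinM.
rewrite ge0_integralZl //; last first.
- apply/measurable_EFinP; apply: measurableT_comp => //; apply: measurable_funB.
    exact: measurable_funM.
  by apply: measurable_funM => //; exact: measurable_funM.
rewrite -[leRHS]mule1; exact: lee_wpmul2l.
Qed.

(** Markov's inequality: [a * P A] is at most the integral of [f] over [A], the bound [a <= f] being
    used almost everywhere. *)
Lemma probability_le_inv (d : measure_display) (T : measurableType d)
    (R : realType) (P : probability T R) (f : T -> R) (A : set T) (a : R) :
  0 < a -> measurable A -> measurable_fun [set: T] f ->
  (forall w, 0 <= f w) -> (\int[P]_w (f w)%:E <= 1)%E ->
  (\forall w \ae P, A w -> a <= f w) -> (P A <= (a^-1)%:E)%E.
Proof.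
move=> a0 mA mf f0 f1 Aa.
rewrite -(@lee_pmul2l _ a%:E) ?lte_fin // -EFinM mulfV ?gt_eqF //.
rewrite -integral_cst //; apply: le_trans f1.
apply: (@le_trans _ _ (\int[P]_(w in A) (f w)%:E)%E).
  apply: ae_ge0_le_integral => //.
  - by move=> w _; rewrite lee_fin ltW.
  - by move=> w _; rewrite lee_fin.
  - by apply: measurable_funTS; exact/measurable_EFinP.
apply: ge0_subset_integral => //; first exact/measurable_EFinP.
by move=> w _; rewrite lee_fin.
Qed.

(** * Pathwise algebra of the stopped sums *)

Section StoppedSums.
Context (R : realType) (M : nat) (eps : R).
Implicit Types (x : nat -> R) (z : nat -> 'rV[R]_M).

(** This is S_t of the overview; [qsum] is V_t. *)
Definition psum x z (t : nat) : 'rV[R]_M := \sum_(i < t.+1) x i *: z i.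

Definition qsum x (t : nat) : R := \sum_(i < t.+1) x i ^+ 2.

Definition near_isometric x z t : bool :=
  ((1 - eps) * qsum x t <= dotv (psum x z t) (psum x z t)) &&
  (dotv (psum x z t) (psum x z t) <= (1 + eps) * qsum x t).

(** A boolean recursion, so that it can guard an [if] and be shown measurable by induction on
    time. *)
Fixpoint near_isometric_upto x z t : bool :=
  if t is t'.+1 then near_isometric_upto x z t' && near_isometric x z t
  else near_isometric x z 0%N.

(* Its inner product with z_(i+1) is the increment of |psum|^2 - qsum. *)
Definition stopped_dir x z i : 'rV[R]_M :=
  if near_isometric_upto x z i then (2 * x i.+1) *: psum x z i else 0.

(** The difference of squares makes the proxies telescope, and [qsum] at [i.+1] is known at time [i]
    when [x] is predictable. *)
Definition stopped_var (a : R) x z i : R :=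
  if near_isometric_upto x z i then a * (qsum x i.+1 ^+ 2 - qsum x i ^+ 2)
  else 0.

Lemma qsumS x t : qsum x t.+1 = qsum x t + x t.+1 ^+ 2.
Proof. by rewrite /qsum big_ord_recr. Qed.

Lemma qsum_ge0 x t : 0 <= qsum x t.
Proof. by apply: sumr_ge0 => i _; exact: sqr_ge0. Qed.

Lemma psumS x z t : psum x z t.+1 = psum x z t + x t.+1 *: z t.+1.
Proof. by rewrite /psum big_ord_recr. Qed.

Lemma near_isometric_uptoP x z t :
  reflect (forall s, (s <= t)%N -> near_isometric x z s)
    (near_isometric_upto x z t).
Proof.
elim: t => [|t IH] /=.
  by apply: (iffP idP) => [h s|]; [rewrite leqn0 => /eqP ->|exact].
apply: (iffP andP) => [[/IH h ht] s|h]; last first.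
  by split; [apply/IH => s st; apply: h; exact: leqW|exact: h].
by rewrite leq_eqVlt => /orP[/eqP -> //|]; rewrite ltnS; exact: h.
Qed.

(** With V = [qsum x i] and y = [x i.+1 ^+ 2], the left side is at most [4 * c0 * (1 + eps) * y * V]
    before stopping, and the right side exceeds this by [2 * c0 * (1 + eps) * y ^+ 2]. *)
Lemma stopped_var_ge x z (c0 : R) i : 0 <= c0 -> 0 <= 1 + eps ->
  c0 * dotv (stopped_dir x z i) (stopped_dir x z i)
    <= stopped_var (2 * (1 + eps) * c0) x z i.
Proof.
move=> c00 e0; rewrite /stopped_dir /stopped_var.
case: near_isometric_uptoP => [/(_ i (leqnn i)) /andP[_ h]|_]; last first.
  by rewrite -(scale0r 0) dotvZl mul0r mulr0.
rewrite dotvZl dotvC dotvZl qsumS.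
have q0 := qsum_ge0 x i; have x0 := sqr_ge0 (x i.+1).
have h1 := ler_wpM2l (mulr_ge0 c00 x0) h.
have h2 : 0 <= c0 * (1 + eps) * (x i.+1 ^+ 2) ^+ 2.
  exact: mulr_ge0 (mulr_ge0 c00 e0) (sqr_ge0 _).
by nra.
Qed.

(** The witness [n] is [m] as long as the bounds have held, and otherwise the first time they fail;
    both sums telescope up to [n]. *)
Lemma stopped_sums x z (a : R) m :
  (forall i, enorm (z i.+1) = 1) ->
  exists2 n, (n <= m)%N &
  [/\ \sum_(i < m) dotv (stopped_dir x z i) (z i.+1) =
        (dotv (psum x z n) (psum x z n) - qsum x n) -
        (dotv (psum x z 0) (psum x z 0) - qsum x 0),
      \sum_(i < m) stopped_var a x z i = a * (qsum x n ^+ 2 - qsum x 0 ^+ 2),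
      near_isometric_upto x z m -> n = m
    & ~~ near_isometric_upto x z m -> ~~ near_isometric x z n].
Proof.
move=> z1; elim: m => [|m [n nm [Ns Bs Gn nGn]]].
  by exists 0%N => //; split; rewrite ?big_ord0 ?subrr ?mulr0.
rewrite !big_ord_recr /= Ns Bs /stopped_dir /stopped_var.
(* After a failure the new terms vanish and [n] stays frozen; before it, [n = m] advances to
   [m.+1]. *)
case: ifPn => [G|nG]; last first.
  exists n; first exact: leqW.
  split => //; last by move=> _; exact: nGn.
  by rewrite -(scale0r 0) dotvZl mul0r addr0.
  by rewrite addr0.
exists m.+1 => //; rewrite (Gn G); split => //.
  (* As [z m.+1] has unit norm, the square [x m.+1 ^+ 2] in the expanded norm cancels the increment
     of [qsum]. *)
  have zz : dotv (z m.+1) (z m.+1) = 1 by rewrite -enorm_sqr z1 expr1n.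
  rewrite psumS qsumS dotvZl !dotvDl ![dotv _ (_ + _)]dotvC !dotvDl !dotvZl.
  rewrite ![dotv _ (_ *: _)]dotvC !dotvZl zz.
  by rewrite (dotvC (z _) (psum _ _ _)); ring.
by ring.
Qed.

End StoppedSums.

(** * Size of the mixture when the bounds fail *)

(** Both denominators equal [a * V ^+ 2], so the root is [V0 / V]. The exponent is at least
    [eps ^+ 2 / (8 * a)], hence at least [ln (K / delta)], and the factor [K] pays for
    [V0 / V >= 1 / K]. *)
Lemma mixture_value_ge (R : realType) (a eps delta K V0 V N : R) :
  0 < a -> 0 < eps -> 0 < delta -> 0 < V0 -> V0 <= V -> V <= V0 * K ->
  8 * a * (ln (1 / delta) + ln K) <= eps ^+ 2 -> eps / 2 * V <= `|N| ->
  1 / delta <= Num.sqrt (a * V0 ^+ 2 / (a * V0 ^+ 2 + a * (V ^+ 2 - V0 ^+ 2)))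
    * expR (N ^+ 2 / (2 * (a * V0 ^+ 2 + a * (V ^+ 2 - V0 ^+ 2)))).
Proof.
move=> a0 e0 d0 V00 V0V VK hL hN.
have V1 : 0 < V by exact: lt_le_trans V0V.
have K0 : 0 < K by rewrite -(pmulr_rgt0 _ V00); exact: lt_le_trans VK.
have -> : a * V0 ^+ 2 + a * (V ^+ 2 - V0 ^+ 2) = a * V ^+ 2 by ring.
have -> : a * V0 ^+ 2 / (a * V ^+ 2) = (V0 / V) ^+ 2.
  by field; rewrite !gt_eqF.
have VV0 : 0 <= V0 / V by rewrite divr_ge0 // ltW.
rewrite sqrtr_sqr ger0_norm //.
have d1 : 0 < 1 / delta by rewrite divr_gt0.
have hE : 1 / delta * K <= expR (N ^+ 2 / (2 * (a * V ^+ 2))).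
  rewrite -[leLHS]lnK; last by rewrite posrE mulr_gt0.
  rewrite ler_expR lnM ?posrE //.
  apply: (@le_trans _ _ (eps ^+ 2 / (8 * a))).
    by rewrite ler_pdivlMr ?mulr_gt0 // mulrC.
  have -> : eps ^+ 2 / (8 * a) = (eps / 2 * V) ^+ 2 / (2 * (a * V ^+ 2)).
    by field; rewrite !gt_eqF.
  rewrite ler_pM2r ?invr_gt0 ?mulr_gt0 ?exprn_gt0 //.
  rewrite -[leRHS]real_normK ?num_real // ler_sqr ?nnegrE //.
  by rewrite !mulr_ge0 ?invr_ge0 // ltW.
apply: le_trans (ler_wpM2l VV0 hE).
have -> : V0 / V * (1 / delta * K) = 1 / delta * (V0 * K / V) by ring.
rewrite -[leLHS]mulr1; apply: ler_wpM2l; first exact: ltW.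
by rewrite ler_pdivlMr // mul1r.
Qed.

(** * Measurability of the stopped quantities *)

Section StoppedMeasurability.
Context (T : pointedType) (R : realType) (M : nat) (F : nat -> set (set T)).
Context (x : nat -> T -> R) (z : nat -> T -> 'rV[R]_M) (eps : R).
Context (leF : forall s t, (s <= t)%N -> F s `<=` F t).
Context (mx0 : measurable_wrt (F 0) (x 0)).
Context (mx : forall t, measurable_wrt (F t) (x t.+1)).
Context (mz : forall t j, measurable_wrt (F t) (fun w => z t w 0 j)).

(** Predictability allows the index [t.+1] at time [t]; index 0 has no predecessor and is handled by
    [mx0]. *)
Lemma measurable_predictable i t : (i <= t.+1)%N -> measurable_wrt (F t) (x i).
Proof.
case: i => [_|i it]; first exact: (measurable_wrt_le (leF (leq0n t)) mx0).
by apply: (measurable_wrt_le _ (@mx i)); exact: leF.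
Qed.

Lemma measurable_qsum i t : (i <= t.+1)%N ->
  measurable_wrt (F t) (fun w => qsum (x^~ w) i).
Proof.
move=> it; apply: measurable_sum => k; apply: measurable_funX.
by apply: measurable_predictable; apply: leq_trans it; rewrite -ltnS.
Qed.

Lemma measurable_psum t j :
  measurable_wrt (F t) (fun w => psum (x^~ w) (z^~ w) t 0 j).
Proof.
rewrite /measurable_wrt /psum; under eq_fun do rewrite summxE.
apply: measurable_sum => k; under eq_fun do rewrite mxE.
apply: measurable_funM.
  by apply: measurable_predictable; exact: ltnW.
by apply: (measurable_wrt_le _ (@mz k j)); apply: leF; rewrite -ltnS.
Qed.

Lemma measurable_near_isometric t :
  measurable_wrt (F t) (fun w => near_isometric eps (x^~ w) (z^~ w) t).
Proof.
have mq : measurable_wrt (F t) (fun w => qsum (x^~ w) t).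
  exact: measurable_qsum.
have ms : measurable_wrt (F t)
    (fun w => dotv (psum (x^~ w) (z^~ w) t) (psum (x^~ w) (z^~ w) t)).
  by apply: measurable_dotv => j; exact: measurable_psum.
apply: measurable_and; apply: measurable_fun_ler => //;
  by apply: measurable_funM => //; exact: measurable_cst.
Qed.

Lemma measurable_near_isometric_upto t :
  measurable_wrt (F t) (fun w => near_isometric_upto eps (x^~ w) (z^~ w) t).
Proof.
elim: t => [|t IH]; first exact: measurable_near_isometric.
apply: measurable_and; last exact: measurable_near_isometric.
exact: (measurable_wrt_le (leF (leqnSn t)) IH).
Qed.

Lemma measurable_stopped_dir t j :
  measurable_wrt (F t) (fun w => stopped_dir eps (x^~ w) (z^~ w) t 0 j).
Proof.
have -> : (fun w => stopped_dir eps (x^~ w) (z^~ w) t 0 j) =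
    fun w => if near_isometric_upto eps (x^~ w) (z^~ w) t
             then 2 * x t.+1 w * psum (x^~ w) (z^~ w) t 0 j else 0.
  by apply/funext => w; rewrite /stopped_dir; case: ifP; rewrite mxE.
apply: measurable_fun_ifT; first exact: measurable_near_isometric_upto.
  apply: measurable_funM; last exact: measurable_psum.
  by apply: measurable_funM; [exact: measurable_cst|exact: mx].
exact: measurable_cst.
Qed.

Lemma measurable_stopped_var a t :
  measurable_wrt (F t) (fun w => stopped_var eps a (x^~ w) (z^~ w) t).
Proof.
apply: measurable_fun_ifT; first exact: measurable_near_isometric_upto.
  apply: measurable_funM; first exact: measurable_cst.
  by apply: measurable_funB; apply: measurable_funX; exact: measurable_qsum.
exact: measurable_cst.
Qed.

End StoppedMeasurability.

(** * Assembling the bound *)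

Theorem theorem1 (d : measure_display) (Omega : measurableType d)
    (R : realType) (P : probability Omega R) (F : nat -> set (set Omega))
    (hF : complete_filtered_space P F)
    (M T : nat) (hM : (1 <= M)%N) (hT : (1 <= T)%N)
    (eps delta c0 cx : R)
    (heps : 0 < eps < 1) (hdelta : 0 < delta < 1) (hc0 : 0 < c0) (hcx : 0 < cx)
    (z : nat -> Omega -> 'rV[R]_M)
    (hz0meas : measurable_wrt (U := borel_rV R M) (F 0%N) (z 0%N))
    (hz0exp : ('E_P[fun w => (enorm (z 0%N w) ^+ 2)%R] = 1)%E)
    (hz0 : \forall w \ae P, `|enorm (z 0%N w) ^+ 2 - 1| <= eps / 2)
    (hzadapted : adapted (U := borel_rV R M) F z)
    (hzsub : cond_subgaussian_vec P F (Num.sqrt (c0 / M%:R)) z)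
    (hznorm : forall t, (1 <= t)%N -> \forall w \ae P, enorm (z t w) = 1)
    (x : nat -> Omega -> R)
    (hxadapted : adapted (fun t => F t.-1) x)
    (hxbound : forall t, (1 <= t)%N -> \forall w \ae P, x t w ^+ 2 <= cx)
    (x0 : R) (hx0 : x0 != 0) (hxx0 : forall w, x 0%N w = x0)
    (hMlarge : 16 * c0 * (1 + eps) / eps ^+ 2
                 * (ln (1 / delta) + ln (1 + cx * T%:R / x0 ^+ 2))
               <= M%:R) :
  ((1 - delta)%:E <=
   P [set w | forall t : nat, (t <= T)%N ->
        ((1 - eps) * (\sum_(0 <= i < t.+1) x i w ^+ 2)
           <= enorm (\sum_(0 <= i < t.+1) x i w *: z i w) ^+ 2
           <= (1 + eps) * (\sum_(0 <= i < t.+1) x i w ^+ 2))%R])%E.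
Proof.
have [hF1 _ _] := hF; have [_ Fm leF] := hF1.
case/andP: heps => e0 e1; case/andP: hdelta => d0 d1.
have M0 : 0 < M%:R :> R by rewrite ltr0n.
pose c := c0 / M%:R; have c_gt0 : 0 < c by rewrite divr_gt0.
pose a := 2 * (1 + eps) * c.
have a0 : 0 < a by apply: mulr_gt0 => //; lra.
have x20 : 0 < x0 ^+ 2 by rewrite exprn_even_gt0.
(* [K] bounds V_t / V_0 almost surely for all t up to [T]. *)
pose K := 1 + cx * T%:R / x0 ^+ 2.
have mx0 : measurable_wrt (F 0%N) (x 0%N).
  by rewrite (_ : x 0%N = cst x0); [exact: measurable_cst|exact/funext].
have mx t : measurable_wrt (F t) (x t.+1) by exact: (hxadapted t.+1 isT).
have mz t j : measurable_wrt (F t) (fun w => z t w 0 j).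
  by apply: measurable_wrt_coord; case: t => [|t] //; exact: hzadapted.
pose u i w := stopped_dir eps (x^~ w) (z^~ w) i.
pose beta i w := stopped_var eps a (x^~ w) (z^~ w) i.
pose N w := \sum_(i < T) dotv (u i w) (z i.+1 w).
pose B w := \sum_(i < T) beta i w.
have mu i j := measurable_stopped_dir eps leF mx0 mx mz i j.
have mb i := measurable_stopped_var eps leF mx0 mx mz a i.
have ub i w : c * dotv (u i w) (u i w) <= beta i w.
  by apply: stopped_var_ge; lra.
have B0 w : 0 <= B w.
  apply: sumr_ge0 => i _; apply: le_trans (ub i w).
  by rewrite mulr_ge0 ?dotvv_ge0 // ltW.
have mN : measurable_fun [set: Omega] N.
  apply: measurable_sum => i; apply: measurable_dotv => j.
    exact: measurable_wrt_fun (mu i j).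
  exact: measurable_wrt_fun (mz i.+1 j).
have mB : measurable_fun [set: Omega] B.
  by apply: measurable_sum => i; exact: measurable_wrt_fun (mb i).
(* The supermartingale bound is applied to the directions [l *: u] with proxies [l ^+ 2 * beta]. *)
have hl l : (\int[P]_w (expR (l * N w - l ^+ 2 * B w / 2))%:E <= 1)%E.
  have sg : Num.sqrt c ^+ 2 = c by rewrite sqr_sqrtr // ltW.
  have h1 i j : measurable_wrt (F i) (fun w => (l *: u i w) 0 j).
    have -> : (fun w => (l *: u i w) 0 j) = fun w => l * u i w 0 j.
      by apply/funext => w; rewrite mxE.
    by apply: measurable_funM; [exact: measurable_cst|exact: mu].
  have h2 i : measurable_wrt (F i) (fun w => l ^+ 2 * beta i w).
    by apply: measurable_funM; [exact: measurable_cst|exact: mb].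
  have h3 i w : Num.sqrt c ^+ 2 * dotv (l *: u i w) (l *: u i w)
      <= l ^+ 2 * beta i w.
    rewrite sg dotvZl dotvC dotvZl.
    by have := ler_wpM2l (sqr_ge0 l) (ub i w); lra.
  apply: le_trans (exp_sum_integral_le1 T hF1 hzsub hzadapted hznorm h1 h2 h3).
  rewrite le_eqVlt; apply/orP; left; apply/eqP; apply: eq_integral => w _.
  congr (expR _)%:E; rewrite /N /B -!mulr_sumr -mulrA mulr_sumr; congr (_ - _).
  by apply: eq_bigr => i _; rewrite dotvZl.
(* This is [a * V_0 ^+ 2], chosen so that [rho + B] collapses to [a * V_n ^+ 2] at the stopping
   index [n]. *)
pose rho := a * (x0 ^+ 2) ^+ 2.
have rho0 : 0 < rho by rewrite mulr_gt0 // exprn_gt0.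
have [mf fint] := gaussian_mixture_le1 rho0 mN mB B0 hl.
set Good := (X in P X).
have GoodE : Good = [set w | near_isometric_upto eps (x^~ w) (z^~ w) T].
  apply/seteqP; split => w /=.
    move=> h; apply/near_isometric_uptoP => t tT.
    by have := h t tT; rewrite !big_mkord enorm_sqr.
  move=> /near_isometric_uptoP h t tT.
  by rewrite !big_mkord enorm_sqr; exact: h.
have mGood : measurable Good.
  apply: (Fm T); rewrite GoodE.
  have [sF _ _] := hF1.
  have mtrue : measurable [set true] by [].
  exact: (measurable_wrt_preimage (sF T)
    (measurable_near_isometric_upto eps leF mx0 mx mz (t := T)) mtrue).
suff PB : (P (~` Good) <= delta%:E)%E.
  rewrite EFinB -[Good]setCK probability_setC; last exact: measurableC.
  by rewrite leeB.
rewrite [delta](_ : _ = (1 / delta)^-1); last by rewrite div1r invrK.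
apply: (probability_le_inv _ (measurableC mGood) _ _ fint).
- by rewrite divr_gt0.
- exact: mf.
- by move=> w; rewrite mulr_ge0 ?sqrtr_ge0 ?expR_ge0.
(* Countably many almost sure events hold simultaneously, so the rest is argued path by path. *)
have Z1 : \forall w \ae P, forall t, enorm (z t.+1 w) = 1.
  by apply: ae_foralln => t; exact: hznorm.
have X1 : \forall w \ae P, forall t, x t.+1 w ^+ 2 <= cx.
  by apply: ae_foralln => t; exact: hxbound.
apply: filterS3 Z1 X1 hz0 => w zw xw z0w; rewrite GoodE => /negP nG.
have [n nT [Nn Bn _ /(_ nG) nn]] := stopped_sums eps (x^~ w) (z := z^~ w) a T zw.
have q0 : qsum (x^~ w) 0 = x0 ^+ 2 by rewrite /qsum big_ord1 hxx0.
have p0 : dotv (psum (x^~ w) (z^~ w) 0) (psum (x^~ w) (z^~ w) 0)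
    = x0 ^+ 2 * enorm (z 0%N w) ^+ 2.
  rewrite /psum big_ord1 hxx0 dotvZl dotvC dotvZl enorm_sqr; ring.
have qn0 : x0 ^+ 2 <= qsum (x^~ w) n.
  rewrite -q0; elim: (n) => [//|k IH]; rewrite qsumS (le_trans IH) //.
  by rewrite lerDl sqr_ge0.
have qnT : qsum (x^~ w) n <= x0 ^+ 2 + cx * n%:R.
  elim: (n) => [|k IH]; first by rewrite q0 mulr0 addr0.
  by rewrite qsumS -natr1; have := xw k; lra.
rewrite /= /rho; have -> : B w = a * (qsum (x^~ w) n ^+ 2 - (x0 ^+ 2) ^+ 2).
  by rewrite /B Bn q0.
apply: (mixture_value_ge (eps := eps) (K := K)) => //.
- apply: (le_trans qnT); rewrite /K mulrDr mulr1 lerD2l mulrCA mulfV ?gt_eqF //.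
  by rewrite mulr1 ler_wpM2l ?ler_nat // ltW.
(* Here [8 * a] is [16 * c0 * (1 + eps) / M], so the condition is the lower bound on [M]
   rearranged. *)
- move: hMlarge; rewrite /a /c -/K; set L := ln _ + ln _ => hM'.
  have : 16 * c0 * (1 + eps) * L <= eps ^+ 2 * M%:R.
    move: hM'; rewrite mulrAC ler_pdivrMr ?exprn_gt0 //; lra.
  move=> h; rewrite -(ler_pM2r M0); apply: le_trans h.
  by rewrite le_eqVlt; apply/orP; left; apply/eqP; field; rewrite gt_eqF.
(* At [n] the deviation exceeds [eps * V_n], while initially it is at most
   [eps * V_0 / 2 <= eps * V_n / 2]; the difference [N] is thus at least [eps * V_n / 2] in modulus,
   negative if the lower bound fails and positive if the upper one does. *)
rewrite /N Nn q0 p0.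
move: nn; rewrite /near_isometric negb_and -!ltNge.
move: z0w; rewrite ler_norml => /andP[]; set y := enorm _ ^+ 2 => y1 y2.
move: qn0; set q := qsum _ _; set p := dotv _ _ => qn0 npq.
have y3 := ler_wpM2l (ltW x20) y1; have y4 := ler_wpM2l (ltW x20) y2.
have qe := ler_wpM2r (ltW e0) qn0.
rewrite ler_normr; apply/orP; case/orP: npq => hpq; [right|left]; nra.
Qed.
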